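(* Let $(R,\mathfrak m)$ be a local ring with positive depth and let $x\in\mathfrak m$ be a non-zerodivisor on $R$. Then the following are equivalent: (1) $R$ satisfies (SAC). (2) $R/xR$ satisfies (SAC).
   Context: All rings are commutative Noetherian with identity. A ring $R$ satisfies (SAC) if for each finitely generated $R$-module $M$: whenever $\mathrm{Ext}_R^i(M,R)=0$ for all $i>0$ and $\mathrm{Ext}_R^i(M,M)=0$ for all sufficiently large $i$, one has $\mathrm{Ext}_R^i(M,M)=0$ for all $i>0$. *)

(* Defs.v *)
From HB Require Import structures.
From mathcomp Require Import all_boot all_algebra.
From mathcomp Require Import boolp classical_sets.

Set Implicit Arguments.
Unset Strict Implicit.
Unset Printing Implicit Defensive.

Import GRing.Theory.
Local Open Scope ring_scope.
Local Open Scope classical_set_scope.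

Definition lspan (R : comNzRingType) (V : lmodType R) (s : seq V) : set V :=
  [set u | exists c : 'I_(size s) -> R, u = \sum_(i < size s) c i *: s`_i].

Definition fg_module (R : comNzRingType) (V : lmodType R) : Prop :=
  exists s : seq V, lspan s = setT.

Definition is_ideal (R : comNzRingType) (I : set R) : Prop :=
  [/\ I 0, (forall a b, I a -> I b -> I (a + b)) & (forall r a, I a -> I (r * a))].

Definition ideal_gen (R : comNzRingType) (s : seq R) : set R := @lspan R R^o s.

Definition noetherian (R : comNzRingType) : Prop :=
  forall I : set R, is_ideal I -> exists s : seq R, I = ideal_gen s.

Definition maximal_ideal (R : comNzRingType) (m : set R) : Prop :=
  [/\ is_ideal m, ~ m 1
    & forall J : set R, is_ideal J -> ~ J 1 -> m `<=` J -> J = m].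

Definition local_ring (R : comNzRingType) (m : set R) : Prop :=
  maximal_ideal m /\ forall n : set R, maximal_ideal n -> n = m.

(* s_i is a non-zerodivisor on R/(s_0, ..., s_(i-1)) for every i, and
   R/(s) <> 0. *)
Definition regular_seq (R : comNzRingType) (s : seq R) : Prop :=
  ~ ideal_gen s 1 /\
  forall i, (i < size s)%N ->
    forall r, ideal_gen (take i s) (s`_i * r) -> ideal_gen (take i s) r.

(* depth R is the supremum of the lengths of the regular sequences in m, so
   it is positive exactly when one of these lengths is. *)
Definition positive_depth (R : comNzRingType) (m : set R) : Prop :=
  exists s : seq R,
    [/\ (0 < size s)%N, (forall y, y \in s -> m y) & regular_seq s].

Section PrincipalQuotient.
Variables (R : comNzRingType) (x : R).

Definition principal_pred : {pred R} :=
  fun y => `[< exists r, y = r * x >].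

Hypothesis x_nonunit : ~ exists r, r * x = 1.

Lemma principal_idealr_closed : idealr_closed principal_pred.
Proof.
split.
- by apply/asboolP; exists 0; rewrite mul0r.
- by apply/asboolP => -[r rx]; apply: x_nonunit; exists r.
- move=> a u v /asboolP[r ->] /asboolP[t ->]; apply/asboolP.
  by exists (a * r + t); rewrite mulrDl mulrA.
Qed.

Definition principal_idealr : idealr R :=
  HB.pack principal_pred
    (GRing.isZmodClosed.Build _ principal_pred
       (idealr_closedB principal_idealr_closed))
    (isProperIdeal.Build _ principal_pred
       (idealr_closed_nontrivial principal_idealr_closed)).

(* The ring R/xR.  The library only equips quotients by proper ideals with a
   ring structure, hence the proof that x is not a unit as an argument. *)
Definition principal_quot : comNzRingType := {ideal_quot principal_idealr}.

End PrincipalQuotient.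

Lemma local_nonunit (R : comNzRingType) (m : set R) (x : R) :
  local_ring m -> m x -> ~ exists r, r * x = 1.
Proof. by move=> [[[_ _ mM] m1 _] _] mx [r rx]; apply: m1; rewrite -rx; apply: mM. Qed.

Definition projective (R : comNzRingType) (P : lmodType R) : Prop :=
  forall (A B : lmodType R) (g : {linear A -> B}) (f : {linear P -> B}),
    (forall b, exists a, g a = b) ->
    exists h : {linear P -> A}, forall p, g (h p) = f p.

Record proj_resolution (R : comNzRingType) (M : lmodType R) := ProjResolution {
  pr_obj : nat -> lmodType R;
  pr_d : forall i, {linear pr_obj i.+1 -> pr_obj i};
  pr_aug : {linear pr_obj 0 -> M};
  pr_projective : forall i, projective (pr_obj i);
  pr_aug_surj : forall u, exists y, pr_aug y = u;
  pr_exact0 : forall y, pr_aug y = 0 <-> exists z, pr_d 0 z = y;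
  pr_exactS : forall i y, pr_d i y = 0 <-> exists z, pr_d i.+1 z = y
}.

Section Ext.
Variables (R : comNzRingType) (M N : lmodType R) (P : proj_resolution M).

(* Cocycles and coboundaries of the complex Hom_R(P, N). *)
Definition ext_cocycle i (f : {linear pr_obj P i -> N}) : Prop :=
  forall z, f (pr_d P i z) = 0.

Definition ext_coboundary i : {linear pr_obj P i -> N} -> Prop :=
  match i with
  | 0 => fun f => forall y, f y = 0
  | j.+1 => fun f =>
      exists g : {linear pr_obj P j -> N}, forall y, f y = g (pr_d P j y)
  end.

End Ext.

(* Ext^i_R(M, N) = H^i(Hom_R(P, N)) = 0; up to isomorphism this cohomology
   does not depend on the projective resolution P of M. *)
Definition Ext_zero (R : comNzRingType) (M N : lmodType R) (i : nat) : Prop :=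
  forall (P : proj_resolution M) (f : {linear pr_obj P i -> N}),
    ext_cocycle f -> ext_coboundary f.

Definition SAC (R : comNzRingType) : Prop :=
  forall M : lmodType R, fg_module M ->
    (forall i, (0 < i)%N -> Ext_zero M R^o i) ->
    (exists n, forall i, (n <= i)%N -> Ext_zero M M i) ->
    forall i, (0 < i)%N -> Ext_zero M M i.

(* Main.v *)
(** Let [S = R/xR].  For an [R]-module [V] on which [x] is regular, with
reduction [V/xV], the cohomology of complexes of free [R]-modules with values
in [V] and in [V/xV] is linked by multiplication by [x].

If [S] satisfies (SAC) and [M] is a test module for [R], replace [M] by its
second syzygy [N], which does not change [Ext^i(M, M)] since
[Ext^i(M, R) = 0]; [N] is [x]-regular and [N/xN] is a test module for [S],
hence [x] acts surjectively on [Ext^i(N, N)] for [i > 0], and Nakayama's lemma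
concludes.

If [R] satisfies (SAC) and [N] is a test module for [S], the first syzygy [M]
of [N] over [R] is a test module for [R].  From [Ext_R^i(M, M) = 0] one gets
[Ext_R^i(M, N) = 0], so that [Ext_S^i(N, N)] embeds in [Ext_S^(i+2)(N, N)] for
[i > 0], and descending induction concludes. *)

Require Import Defs.
From HB Require Import structures.
From mathcomp Require Import all_boot all_algebra.
From mathcomp Require Import boolp classical_sets.

Set Implicit Arguments.
Unset Strict Implicit.
Unset Printing Implicit Defensive.

Import GRing.Theory.
Local Open Scope ring_scope.
Local Open Scope classical_set_scope.

(** * Packing of linear maps and dependent choice *)

Definition linear_of (R : comNzRingType) (U V : lmodType R) (f : U -> V)
  (fL : linear f) : {linear U -> V} :=
  HB.pack f (GRing.isLinear.Build R U V *:%R f fL).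

(** Builds chain maps and homotopies degree by degree: [I] is what makes the next extension
    possible, [E] is the compatibility of consecutive degrees. *)
Lemma dependent_choice_seq (T : nat -> Type) (I : forall i, T i -> Prop)
    (E : forall i, T i -> T i.+1 -> Prop) :
  (exists t, I 0 t) ->
  (forall i t, I i t -> exists t', I i.+1 t' /\ E i t t') ->
  exists s : forall i, T i, forall i, I i (s i) /\ E i (s i) (s i.+1).
Proof.
move=> /cid[t0 I0] next.
pose step i (u : {t : T i | I i t}) : {t : T i.+1 | I i.+1 t} :=
  let w := cid (next i _ (svalP u)) in exist _ (sval w) (svalP w).1.
pose fix s i : {t : T i | I i t} :=
  if i is j.+1 then step j (s j) else exist _ t0 I0.
exists (fun i => sval (s i)) => i; split; first exact: (svalP (s i)).
exact: (svalP (cid (next i _ (svalP (s i))))).2.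
Qed.

(** * Submodules, free and projective modules *)

Section LinearAlgebra.
Variable R : comNzRingType.
Implicit Types U V W : lmodType R.

(** Preimages under the injective [j] are unique, so choosing them pointwise is automatically
    linear. *)
Lemma linear_factor_inj U V W (j : {linear V -> W}) (f : {linear U -> W}) :
  (forall v, j v = 0 -> v = 0) -> (forall u, exists v, j v = f u) ->
  exists g : {linear U -> V}, forall u, j (g u) = f u.
Proof.
move=> jinj /choice[g gE].
have gL : linear g.
  move=> a u v; apply/eqP; rewrite -subr_eq0; apply/eqP/jinj.
  by rewrite linearB /= linearP /= !gE linearP subrr.
by exists (linear_of gL).
Qed.

Definition submodule_set V (A : V -> Prop) : Prop :=
  A 0 /\ forall a u v, A u -> A v -> A (a *: u + v).

Record submodule V := Submodule {
  submodule_mem :> V -> Prop;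
  submoduleP : submodule_set submodule_mem }.

Definition submod_pred V (A : submodule V) : {pred V} := fun v => `[< A v >].

Lemma submod_pred_closed V (A : submodule V) : submod_closed (submod_pred A).
Proof.
case: (submoduleP A) => A0 AL; split; first exact/asboolP.
by move=> a u v /asboolP Au /asboolP Av; apply/asboolP/AL.
Qed.

HB.instance Definition _ V (A : submodule V) :=
  GRing.isSubmodClosed.Build R V (submod_pred A) (submod_pred_closed A).

Record submod V (A : submodule V) := Submod {
  submod_val : V; submod_valP : submod_val \in submod_pred A }.

HB.instance Definition _ V (A : submodule V) := [isSub for @submod_val V A].
HB.instance Definition _ V (A : submodule V) := [Choice of submod A by <:].
HB.instance Definition _ V (A : submodule V) :=
  [SubChoice_isSubLmodule of submod A by <:].

Definition submod_incl V (A : submodule V) : {linear submod A -> V} := val.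

Lemma submod_incl_inj V (A : submodule V) (v : submod A) :
  submod_incl A v = 0 -> v = 0.
Proof. by move=> v0; apply: val_inj; rewrite [LHS]v0. Qed.

Lemma submod_inclP V (A : submodule V) v :
  A v <-> exists w : submod A, submod_incl A w = v.
Proof.
split=> [Av|[w <-]]; last by apply/asboolP; exact: (submod_valP w).
have Aw : v \in submod_pred A by apply/asboolP.
by exists (Submod Aw).
Qed.

Lemma ker_submodule U V (f : {linear U -> V}) :
  submodule_set (fun u => f u = 0).
Proof.
split=> [|a u v fu fv]; first exact: linear0.
by rewrite linearP fu fv scaler0 addr0.
Qed.

Lemma im_submodule U V (f : {linear U -> V}) :
  submodule_set (fun v => exists u, f u = v).
Proof.
split=> [|a u v [u' <-] [v' <-]]; first by exists 0; rewrite linear0.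
by exists (a *: u' + v'); rewrite linearP.
Qed.

Definition ker U V (f : {linear U -> V}) := Submodule (ker_submodule f).
Definition im U V (f : {linear U -> V}) := Submodule (im_submodule f).

Lemma corestrict U V (A : submodule V) (f : {linear U -> V}) :
  (forall u, A (f u)) ->
  exists g : {linear U -> submod A}, forall u, submod_incl A (g u) = f u.
Proof.
move=> Af; apply: linear_factor_inj => [v|u]; first exact: submod_incl_inj.
exact/submod_inclP.
Qed.

(** Projectivity lifts along surjections only, so both maps are first corestricted to the image of
    [g]. *)
Lemma projective_lift U V W (g : {linear V -> W}) (f : {linear U -> W}) :
  projective U -> (forall u, exists v, g v = f u) ->
  exists h : {linear U -> V}, forall u, g (h u) = f u.
Proof.
move=> projU fg.
have [f' f'E] := corestrict (A := im g) fg.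
have [g' g'E] : exists g' : {linear V -> submod (im g)},
    forall v, submod_incl _ (g' v) = g v.
  by apply: corestrict => v; exists v.
have [|h hE] := projU _ _ g' f'.
  move=> w; have /submod_inclP[v vE] :
    exists w', submod_incl (im g) w' = submod_incl (im g) w by exists w.
  exists v; apply/eqP; rewrite -subr_eq0; apply/eqP/submod_incl_inj.
  by rewrite linearB g'E vE subrr.
by exists h => u; rewrite -g'E hE f'E.
Qed.

Definition free_module (n : nat) : lmodType R := {ffun 'I_n -> R^o}.

Definition lincomb V n (v : 'I_n -> V) (c : free_module n) : V :=
  \sum_i (c i : R) *: v i.

Lemma lincomb_linear V n (v : 'I_n -> V) : linear (lincomb v).
Proof.
move=> a c e; rewrite /lincomb scaler_sumr -big_split /=; apply: eq_bigr => i _.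
by rewrite !ffunE scalerDl scalerA.
Qed.

Definition lincomb_lin V n (v : 'I_n -> V) := linear_of (lincomb_linear v).

Definition delta n (i : 'I_n) : free_module n := [ffun j => (j == i)%:R].

Lemma linear_lincomb V n (f : {linear free_module n -> V}) c :
  f c = lincomb (fun i => f (delta i)) c.
Proof.
have {1}-> : c = \sum_i (c i : R) *: delta i.
  apply/ffunP => j; rewrite sum_ffunE (bigD1 j) //= big1 => [|i /negPf ij].
    by rewrite !ffunE eqxx addr0 /GRing.scale/= mulr1.
  by rewrite !ffunE eq_sym ij /GRing.scale/= mulr0.
by rewrite linear_sum; apply: eq_bigr => i _; rewrite linearZ.
Qed.

Lemma lincomb_delta V n (v : 'I_n -> V) i : lincomb v (delta i) = v i.
Proof.
rewrite /lincomb (bigD1 i) //= big1 => [|j /negPf ij].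
  by rewrite ffunE eqxx scale1r addr0.
by rewrite ffunE ij scale0r.
Qed.

Lemma free_projective n : projective (free_module n).
Proof.
move=> A B g f gsurj.
have [v vE] := choice (fun i => gsurj (f (delta i))).
exists (lincomb_lin v) => c; rewrite /= [RHS]linear_lincomb /lincomb linear_sum.
by apply: eq_bigr => i _; rewrite linearZ /= vE.
Qed.

Lemma inl_linear U V : linear (fun u : U => (u, 0 : V)).
Proof. by move=> a u v; congr pair; rewrite /= scaler0 addr0. Qed.
Lemma inr_linear U V : linear (fun v : V => (0 : U, v)).
Proof. by move=> a u v; congr pair; rewrite /= scaler0 addr0. Qed.

Lemma copair_linear U V W (f : {linear U -> W}) (g : {linear V -> W}) :
  linear (fun p : U * V => f p.1 + g p.2).
Proof.
by move=> a p q; rewrite /= !linearP scalerDr addrACA.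
Qed.

Definition copair U V W (f : {linear U -> W}) (g : {linear V -> W}) :=
  linear_of (copair_linear f g).

Lemma linear_pair U V W (f : {linear (U * V)%type -> W}) :
  exists (g : {linear U -> W}) (h : {linear V -> W}),
    forall u v, f (u, v) = g u + h v.
Proof.
exists (f \o linear_of (@inl_linear U V)), (f \o linear_of (@inr_linear U V)).
by move=> u v; rewrite /= -linearD; congr (f (_, _)); rewrite /= (addr0, add0r).
Qed.

Lemma prod_projective U V :
  projective U -> projective V -> projective (U * V)%type.
Proof.
move=> pU pV A B g f gsurj; have [f1 [f2 fE]] := linear_pair f.
have [h1 h1E] := pU _ _ g f1 gsurj; have [h2 h2E] := pV _ _ g f2 gsurj.
by exists (copair h1 h2) => -[u v]; rewrite /= linearD h1E h2E fE.
Qed.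

Definition regular_on (x : R) V := forall v : V, x *: v = 0 -> v = 0.

Lemma free_regular x n : GRing.lreg x -> regular_on x (free_module n).
Proof.
move=> xreg c xc; apply/ffunP => i; apply: xreg; rewrite !ffunE mulr0.
by have := congr1 (fun c : free_module n => c i) xc; rewrite /= !ffunE.
Qed.

Lemma submod_regular x V (A : submodule V) :
  regular_on x V -> regular_on x (submod A).
Proof.
move=> xV v xv0; apply: submod_incl_inj; apply: xV.
by rewrite -linearZ xv0 linear0.
Qed.

Lemma linear_divide x U V (f : {linear U -> V}) :
  regular_on x V -> (forall u, exists v, x *: v = f u) ->
  exists g : {linear U -> V}, forall u, f u = x *: g u.
Proof.
move=> xV fx.
have xL : linear ( *:%R x : V -> V).
  by move=> a u v; rewrite scalerDr !scalerA mulrC.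
have [//|g gE] := linear_factor_inj (j := linear_of xL) (f := f) _ fx.
by exists g => u; rewrite -gE.
Qed.

End LinearAlgebra.

(** * Vanishing of Ext and independence of the resolution *)

Section Vanishing.
Variable R : comNzRingType.
Implicit Types A U V W : lmodType R.

(** Vanishing of the middle cohomology of Hom(A, V). The condition [d0 d1 = 0] is not built in,
    since the maps used later may form a complex only modulo [x]. *)
Definition vanishes V A2 A1 A0 (d1 : {linear A2 -> A1}) (d0 : {linear A1 -> A0}) :=
  forall f : {linear A1 -> V}, (forall z, f (d1 z) = 0) ->
    exists g : {linear A0 -> V}, forall y, f y = g (d0 y).

Definition short_exact U V W (j : {linear U -> V}) (p : {linear V -> W}) :=
  [/\ (forall u, j u = 0 -> u = 0), (forall w, exists v, p v = w)
    & forall v, p v = 0 <-> exists u, j u = v].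

Lemma ker_short_exact V W (p : {linear V -> W}) :
  (forall w, exists v, p v = w) -> short_exact (submod_incl (ker p)) p.
Proof.
move=> psurj; split=> //; first exact: submod_incl_inj.
by move=> v; exact: (submod_inclP (ker p) v).
Qed.

(** The piece H^i(V) -> H^i(W) -> H^(i+1)(U) of the long exact sequence: [g] represents the
    connecting class, and killing it by [k] corrects the lift [f'] to a cocycle. *)
Lemma vanishes_quotient U V W (j : {linear U -> V}) (p : {linear V -> W})
    A3 A2 A1 A0 (d2 : {linear A3 -> A2}) (d1 : {linear A2 -> A1})
    (d0 : {linear A1 -> A0}) :
  short_exact j p -> projective A1 -> (forall z, d1 (d2 z) = 0) ->
  (forall z, d0 (d1 z) = 0) ->
  vanishes U d2 d1 -> vanishes V d1 d0 -> vanishes W d1 d0.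
Proof.
move=> [jinj psurj jp] P1 d12 d01 vU vV f fd.
have [f' f'E] := P1 _ _ p f psurj.
have [|g gE] := linear_factor_inj (f := f' \o d1) jinj.
  by move=> u; apply/jp; rewrite /= f'E fd.
have [|k kE] := vU g.
  by move=> z; apply: jinj; rewrite gE /= d12 linear0.
have [|h hE] := vV (f' \- (j \o k)).
  by move=> z; rewrite /= -kE gE subrr.
exists (p \o h) => y.
have /(congr1 p) := hE y; rewrite /= linearB /= f'E => <-.
by rewrite (jp (j (k y))).2 ?subr0 //; exists (k y).
Qed.

(** The piece H^(i-1)(W) -> H^i(U) -> H^i(V) of the long exact sequence. *)
Lemma vanishes_sub U V W (j : {linear U -> V}) (p : {linear V -> W})
    A3 A2 A1 A0 (d2 : {linear A3 -> A2}) (d1 : {linear A2 -> A1})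
    (d0 : {linear A1 -> A0}) :
  short_exact j p -> projective A0 -> (forall z, d0 (d1 z) = 0) ->
  vanishes W d1 d0 -> vanishes V d2 d1 -> vanishes U d2 d1.
Proof.
move=> [jinj psurj jp] P0 d01 vW vV f fd.
have [|g gE] := vV (j \o f).
  by move=> z; rewrite /= fd linear0.
have [|k kE] := vW (p \o g).
  by move=> z; rewrite /= -gE; apply/jp; exists (f z).
have [k' k'E] := P0 _ _ p k psurj.
have [|g' g'E] := linear_factor_inj (f := g \- (k' \o d0)) jinj.
  by move=> y; apply/jp; rewrite /= linearB /= k'E -kE subrr.
exists g' => y; apply/eqP; rewrite -subr_eq0; apply/eqP/jinj.
by rewrite linearB /= g'E /= d01 linear0 subr0 -gE subrr.
Qed.

Lemma vanishes_free n A2 A1 A0 (d1 : {linear A2 -> A1}) (d0 : {linear A1 -> A0}) :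
  vanishes R^o d1 d0 -> vanishes (free_module R n) d1 d0.
Proof.
move=> vR f fd.
have coordL i : linear (fun c : free_module R n => c i : R^o).
  by move=> a u v; rewrite !ffunE.
have [|g gE] := choice (X := 'I_n) (Y := {linear A0 -> R^o})
    (P := fun i g => forall y, f y i = g (d0 y)).
  move=> i; have [|g gE] := vR (linear_of (coordL i) \o f).
    by move=> z; rewrite /= fd ffunE.
  by exists g => y; rewrite -gE.
have gL : linear (fun a => [ffun i => g i a] : free_module R n).
  by move=> a u v; apply/ffunP => i; rewrite !ffunE linearP.
by exists (linear_of gL) => y; apply/ffunP => i; rewrite ffunE gE.
Qed.

Lemma pr_dd (M : lmodType R) (P : proj_resolution M) i z :
  pr_d P i (pr_d P i.+1 z) = 0.
Proof. by apply/(@pr_exactS _ _ P); exists z. Qed.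

Lemma pr_aug_d (M : lmodType R) (P : proj_resolution M) z :
  pr_aug P (pr_d P 0 z) = 0.
Proof. by apply/(@pr_exact0 _ _ P); exists z. Qed.

(** * Comparison of projective resolutions *)

Lemma comparison (M : lmodType R) (P Q : proj_resolution M) :
  exists a : forall i, {linear pr_obj P i -> pr_obj Q i},
    (forall y, pr_aug Q (a 0 y) = pr_aug P y) /\
    forall i z, pr_d Q i (a i.+1 z) = a i (pr_d P i z).
Proof.
(* The invariant says that [a] sends boundaries to boundaries, which allows the next lift; its
   second half keeps the augmentation in degree 0. *)
have [] := @dependent_choice_seq (fun i => {linear pr_obj P i -> pr_obj Q i})
  (fun i a => (forall z, exists w, pr_d Q i w = a (pr_d P i z)) /\
     match i return {linear pr_obj P i -> pr_obj Q i} -> Prop with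
     | 0 => fun a => forall y, pr_aug Q (a y) = pr_aug P y
     | _ => fun _ => True end a)
  (fun i a b => forall z, pr_d Q i (b z) = a (pr_d P i z)).
- have [a aE] := pr_projective (p := P) (i := 0) (g := pr_aug Q)
    (pr_aug P) (@pr_aug_surj _ _ Q).
  exists a; split=> // z; apply/(@pr_exact0 _ _ Q).
  by rewrite aE pr_aug_d.
- move=> i a [aI _].
  have [b bE] := projective_lift (f := a \o pr_d P i)
    (@pr_projective _ _ P i.+1) aI.
  exists b; do 2!split=> //; move=> z; apply/(@pr_exactS _ _ Q).
  by rewrite bE /= pr_dd linear0.
- by move=> a aE; exists a; split=> [|i]; [case: (aE 0) => -[]|case: (aE i)].
Qed.

Lemma null_homotopy (M : lmodType R) (Q : proj_resolution M)
    (c : forall i, {linear pr_obj Q i -> pr_obj Q i}) :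
  (forall y, pr_aug Q (c 0 y) = 0) ->
  (forall i z, pr_d Q i (c i.+1 z) = c i (pr_d Q i z)) ->
  exists h : forall i, {linear pr_obj Q i -> pr_obj Q i.+1},
    forall i y, c i.+1 y = pr_d Q i.+1 (h i.+1 y) + h i (pr_d Q i y).
Proof.
move=> c0 cS.
(* On boundaries the lower term of the homotopy identity dies, leaving [d h d = c d]; this makes the
   next difference [c - h d] a cycle. *)
have [] := @dependent_choice_seq (fun i => {linear pr_obj Q i -> pr_obj Q i.+1})
  (fun i h => forall z, pr_d Q i (h (pr_d Q i z)) = c i (pr_d Q i z))
  (fun i h h' => forall y, c i.+1 y = pr_d Q i.+1 (h' y) + h (pr_d Q i y)).
- have [|h hE] := projective_lift (g := pr_d Q 0) (f := c 0)
    (@pr_projective _ _ Q 0).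
    by move=> y; apply/(@pr_exact0 _ _ Q)/c0.
  by exists h => z; rewrite hE.
- move=> i h hI.
  have [|h' h'E] := projective_lift (g := pr_d Q i.+1)
      (f := c i.+1 \- (h \o pr_d Q i)) (@pr_projective _ _ Q i.+1).
    by move=> y; apply/(@pr_exactS _ _ Q); rewrite /= linearB /= cS hI subrr.
  exists h'; split=> [z|y].
    by rewrite h'E /= pr_dd linear0 subr0.
  by rewrite h'E /= subrK.
- by move=> h hE; exists h => i; case: (hE i).
Qed.

(** As [1 - a b] is null-homotopic, a cocycle on [Q] is cohomologous to its pullback along [a b],
    which passes through [P]. *)
Lemma vanishes_comparison (M V : lmodType R) (P Q : proj_resolution M) i :
  vanishes V (pr_d P i.+1) (pr_d P i) -> vanishes V (pr_d Q i.+1) (pr_d Q i).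
Proof.
move=> vP f fd.
have [a [a0 aS]] := comparison P Q; have [b [b0 bS]] := comparison Q P.
have [||h hE] := null_homotopy (Q := Q) (c := fun i => idfun \- (a i \o b i)).
- by move=> y; rewrite /= linearB /= a0 b0 subrr.
- by move=> j z; rewrite /= linearB /= aS bS.
have [|g gE] := vP (f \o a i.+1).
  by move=> z; rewrite /= -aS fd.
exists ((f \o h i) \+ (g \o b i)) => y.
rewrite /= -bS -gE /=; have /eqP := hE i y.
rewrite /= subr_eq => /eqP {1}->.
by rewrite !linearD /= fd add0r.
Qed.

Lemma Ext_zeroP (M V : lmodType R) (P : proj_resolution M) i :
  Ext_zero M V i.+1 <-> vanishes V (pr_d P i.+1) (pr_d P i).
Proof.
split=> [vM|vP Q]; first exact: (vM P).
exact: vanishes_comparison vP.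
Qed.

End Vanishing.

(** * Finitely generated modules over Noetherian rings *)

Section Noetherian.
Variable R : comNzRingType.
Implicit Types U V W : lmodType R.

Lemma lspanE V (s : seq V) u :
  lspan s u <-> exists c : free_module R (size s), u = lincomb (fun i => s`_i) c.
Proof.
split=> [[c ->]|[c ->]]; last by exists (fun i => c i).
by exists [ffun i => c i]; apply: eq_bigr => i _; rewrite ffunE.
Qed.

Lemma lspan_submodule V (s : seq V) : submodule_set (lspan s).
Proof.
split=> [|a u v /lspanE[c ->] /lspanE[e ->]]; apply/lspanE.
  by exists 0; rewrite -[RHS]/(lincomb_lin _ _) linear0.
by exists (a *: c + e); rewrite lincomb_linear.
Qed.

Lemma lspan_mem V (s : seq V) u : u \in s -> lspan s u.
Proof.
move=> us; have us' := us; rewrite -index_mem in us'; apply/lspanE.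
by exists (delta R (Ordinal us')); rewrite lincomb_delta nth_index.
Qed.

Lemma submodule_setD V (A : V -> Prop) u v :
  submodule_set A -> A u -> A v -> A (u + v).
Proof. by move=> [_ AL] Au Av; rewrite -[u]scale1r; exact: AL. Qed.

Lemma submodule_setZ V (A : V -> Prop) a u :
  submodule_set A -> A u -> A (a *: u).
Proof. by move=> [A0 AL] Au; rewrite -[X in A X]addr0; exact: AL. Qed.

Lemma submodule_setB V (A : V -> Prop) u v :
  submodule_set A -> A u -> A v -> A (u - v).
Proof. by move=> [_ AL] Au Av; rewrite addrC -scaleN1r; exact: AL. Qed.

Lemma lspan_min V (s : seq V) (A : V -> Prop) :
  submodule_set A -> (forall u, u \in s -> A u) -> forall u, lspan s u -> A u.
Proof.
move=> subA sA u [c ->]; elim/big_ind: _ => //; first by case: subA.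
  by move=> v w; exact: submodule_setD.
by move=> i _; apply: submodule_setZ => //; apply/sA/mem_nth.
Qed.

Definition noetherian_module V := forall A : V -> Prop,
  submodule_set A -> exists s : seq V, forall u, A u <-> lspan s u.

Lemma preim_submodule U V (f : {linear U -> V}) (A : V -> Prop) :
  submodule_set A -> submodule_set (fun u => A (f u)).
Proof.
move=> [A0 AL]; split=> [|a u v fu fv]; first by rewrite linear0.
by rewrite linearP; exact: AL.
Qed.

Lemma image_submodule U V (f : {linear U -> V}) (A : U -> Prop) :
  submodule_set A -> submodule_set (fun v => exists2 u, A u & f u = v).
Proof.
move=> [A0 AL]; split=> [|a u v [u' Au <-] [v' Av <-]].
  by exists 0; rewrite ?linear0.
by exists (a *: u' + v'); [exact: AL | rewrite linearP].
Qed.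

Lemma lift_seq U V (f : U -> V) (A : U -> Prop) (t : seq V) :
  (forall v, v \in t -> exists2 u, A u & f u = v) ->
  exists s : seq U, (forall u, u \in s -> A u) /\ map f s = t.
Proof.
elim: t => [|v t IH] tA; first by exists [::].
have [u Au fu] := tA v (mem_head _ _).
have [|s [sA <-]] := IH; first by move=> w wt; apply: tA; rewrite in_cons wt orbT.
exists (u :: s); split=> [w|]; last by rewrite /= fu.
by rewrite in_cons => /orP[/eqP->|/sA].
Qed.

(** [A] is generated by lifts of generators of its image in [W] together with the images of
    generators of its preimage in [U]. *)
Lemma noetherian_extension U V W (j : {linear U -> V}) (p : {linear V -> W}) :
  (forall v, p v = 0 -> exists u, j u = v) ->
  noetherian_module U -> noetherian_module W -> noetherian_module V.
Proof.
move=> jp nU nW A subA.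
have [t tE] := nW _ (image_submodule p subA).
have [|s [sA sE]] := lift_seq (f := p) (A := A) (t := t).
  by move=> w wt; apply/tE/lspan_mem.
have [r rE] := nU _ (preim_submodule j subA).
exists (s ++ map j r) => v; split=> [Av|]; last first.
  apply: lspan_min => // u; rewrite mem_cat => /orP[/sA //|/mapP[w wr ->]].
  exact/rE/lspan_mem.
have sub_sr := lspan_submodule (s ++ map j r).
have [v' v's pv'] : exists2 v', lspan s v' & p v' = p v.
  apply: (lspan_min (s := t) (image_submodule p (lspan_submodule s))).
    by move=> w; rewrite -sE => /mapP[u us ->]; exists u => //; exact: lspan_mem.
  by apply/tE; exists v.
have Av' : A v' by apply: lspan_min v's.
have [|w wE] := jp (v - v'); first by rewrite linearB /= pv' subrr.
rewrite -(subrK v' v) -wE; apply: submodule_setD => //; last first.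
  by apply: lspan_min v's => // u us; apply: lspan_mem; rewrite mem_cat us.
apply: (lspan_min (s := r) (preim_submodule j sub_sr)) => [u ur|].
  by apply: lspan_mem; rewrite mem_cat map_f ?orbT.
by apply/rE; rewrite wE; exact: submodule_setB.
Qed.

Lemma noetherian_power V n : noetherian_module V ->
  noetherian_module ({ffun 'I_n -> V} : lmodType R).
Proof.
move=> nV; elim: n => [|n IH].
  move=> A [A0 _]; exists [::] => u.
  have -> : u = 0 by apply/ffunP => -[].
  by split=> // _; case: (lspan_submodule ([::] : seq {ffun 'I_0 -> V})).
have pL : linear (fun c : {ffun 'I_n.+1 -> V} => c ord0).
  by move=> a u v; rewrite !ffunE.
(* Extension by 0 at [ord0] embeds V^n as the kernel of the coordinate [ord0]. *)
have jL : linear (fun c : {ffun 'I_n -> V} =>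
    [ffun i => oapp c 0 (unlift ord0 i)] : {ffun 'I_n.+1 -> V}).
  move=> a u v; apply/ffunP => i; rewrite !ffunE.
  by case: unlift => [k|] /=; rewrite ?ffunE // scaler0 addr0.
apply: (noetherian_extension (j := linear_of jL) (p := linear_of pL)) => //.
move=> c /= c0; exists [ffun i => c (lift ord0 i)]; apply/ffunP => i.
by rewrite ffunE; case: unliftP => [k|] -> //=; rewrite ffunE.
Qed.

Lemma noetherian_inj V W (j : {linear V -> W}) :
  (forall v, j v = 0 -> v = 0) -> noetherian_module W -> noetherian_module V.
Proof.
move=> jinj nW A subA; have [t tE] := nW _ (image_submodule j subA).
have [|s [sA sE]] := lift_seq (f := j) (A := A) (t := t).
  by move=> w wt; apply/tE/lspan_mem.
exists s => v; split=> [Av|]; last exact: lspan_min.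
have [v' v's jv'] : exists2 v', lspan s v' & j v' = j v.
  apply: (lspan_min (s := t) (image_submodule j (lspan_submodule s))).
    by move=> w; rewrite -sE => /mapP[u us ->]; exists u => //; exact: lspan_mem.
  by apply/tE; exists v.
suff -> : v = v' by [].
by apply/eqP; rewrite -subr_eq0; apply/eqP/jinj; rewrite linearB /= jv' subrr.
Qed.

Lemma noetherian_free n : noetherian R -> noetherian_module (free_module R n).
Proof.
move=> nR; apply: noetherian_power => A [A0 AL].
have [|s sE] := nR A.
  split=> // [a b|r a]; first exact: (@submodule_setD R^o A a b (conj A0 AL)).
  exact: (@submodule_setZ R^o A r a (conj A0 AL)).
by exists s => u; rewrite sE.
Qed.

Lemma fg_moduleP V :
  fg_module V <->
  exists n (p : {linear free_module R n -> V}), forall v, exists c, p c = v.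
Proof.
split=> [[s sE]|[n [p psurj]]].
  exists (size s), (lincomb_lin (fun i => s`_i)) => v.
  have : lspan s v by rewrite sE.
  by move=> /lspanE[c ->]; exists c.
exists [seq p (delta R i) | i : 'I_n].
rewrite predeqE => v; split=> // _; have [c <-] := psurj v.
rewrite linear_lincomb /lincomb; elim/big_ind: _.
- by case: (lspan_submodule [seq p (delta R i) | i : 'I_n]).
- by move=> u w; exact: submodule_setD (lspan_submodule _).
- move=> i _; apply: submodule_setZ; first exact: lspan_submodule.
  by apply/lspan_mem/mapP; exists i; rewrite ?mem_enum.
Qed.

Lemma fg_module_surj V W (p : {linear V -> W}) :
  (forall w, exists v, p v = w) -> fg_module V -> fg_module W.
Proof.
move=> psurj /fg_moduleP[n [q qsurj]]; apply/fg_moduleP; exists n, (p \o q) => w.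
by have [v <-] := psurj w; have [c <-] := qsurj v; exists c.
Qed.

Lemma fg_module_free n : fg_module (free_module R n).
Proof. by apply/fg_moduleP; exists n, idfun => c; exists c. Qed.

Lemma fg_module_prod V W : fg_module V -> fg_module W ->
  fg_module (V * W)%type.
Proof.
move=> [s sE] [t tE].
pose j1 := linear_of (@inl_linear R V W); pose j2 := linear_of (@inr_linear R V W).
exists (map j1 s ++ map j2 t); rewrite predeqE => -[v w]; split=> // _.
have sub := lspan_submodule (map j1 s ++ map j2 t).
have -> : (v, w) = j1 v + j2 w by congr pair; rewrite /= (addr0, add0r).
apply: submodule_setD => //.
- apply: (lspan_min (s := s) (preim_submodule j1 sub)); last by rewrite sE.
  by move=> u us; apply: lspan_mem; rewrite mem_cat map_f.
- apply: (lspan_min (s := t) (preim_submodule j2 sub)); last by rewrite tE.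
  by move=> u us; apply: lspan_mem; rewrite mem_cat map_f ?orbT.
Qed.

(** * Free resolutions of finite rank in each degree *)

Record free_resolution (M : lmodType R) := FreeResolution {
  fr_rank : nat -> nat;
  fr_d : forall i,
    {linear free_module R (fr_rank i.+1) -> free_module R (fr_rank i)};
  fr_aug : {linear free_module R (fr_rank 0) -> M};
  fr_aug_surj : forall u, exists y, fr_aug y = u;
  fr_exact0 : forall y, fr_aug y = 0 <-> exists z, fr_d 0 z = y;
  fr_exactS : forall i y, fr_d i y = 0 <-> exists z, fr_d i.+1 z = y
}.

Definition proj_of_free M (F : free_resolution M) : proj_resolution M :=
  @ProjResolution R M (fun i => free_module R (fr_rank F i)) (fr_d F) (fr_aug F)
    (fun i => @free_projective R _) (@fr_aug_surj _ F) (@fr_exact0 _ F)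
    (@fr_exactS _ F).

Lemma free_cover_ker (nR : noetherian R) n V
    (f : {linear free_module R n -> V}) :
  {k & {d : {linear free_module R k -> free_module R n} |
    forall y, f y = 0 <-> exists z, d z = y}}.
Proof.
have /cid[s sE] := noetherian_free nR (ker_submodule f).
exists (size s), (lincomb_lin (fun i => s`_i)) => y; rewrite sE.
by split=> [/lspanE[c ->]|[c <-]]; [exists c|apply/lspanE; exists c].
Qed.

Lemma fg_free_resolution (nR : noetherian R) (M : lmodType R) :
  fg_module M -> inhabited (free_resolution M).
Proof.
move=> /fg_moduleP[n [p psurj]].
(* A map packed with its ranks. [step] replaces it by a cover of its kernel, whose target rank is by
   conversion the former source rank, so that the differentials compose without casts. *)
pose T := {k & {l & {linear free_module R k -> free_module R l}}}.
pose step (t : T) : T := let u := free_cover_ker nR (projT2 (projT2 t)) in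
  existT _ (projT1 u) (existT _ (projT1 t) (sval (projT2 u))).
pose u0 := free_cover_ker nR p.
pose t0 : T := existT _ (projT1 u0) (existT _ n (sval (projT2 u0))).
pose rank i := if i is j.+1 then projT1 (iter j step t0) else n.
pose d i : {linear free_module R (rank i.+1) -> free_module R (rank i)} :=
  match i with
  | 0 => sval (projT2 u0)
  | j.+1 => projT2 (projT2 (iter j.+1 step t0)) end.
constructor; apply: (@FreeResolution M rank d p psurj) => [y|].
  exact: (svalP (projT2 u0)).
by case=> [|i] y; exact: (svalP (projT2 (free_cover_ker nR _))).
Qed.

(* Induction on the number of generators: since [1 - x a] is a unit, the last
   generator is redundant modulo [B] and the others. *)
Lemma nakayama V (x : R) (s : seq V) (Z B : V -> Prop) :
  (forall a, exists b, b * (1 - x * a) = 1) -> submodule_set B ->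
  (forall v, Z v -> exists u w, [/\ lspan s u, B w & v = u + w]) ->
  (forall v, v \in s -> Z v) ->
  (forall v, Z v -> exists u w, [/\ Z u, B w & v = x *: u + w]) ->
  forall v, Z v -> B v.
Proof.
move=> unit1x subB.
elim: s => [|e s IH] Zgen sZ ZxB v Zv.
  have [u [w [[c ->] Bw ->]]] := Zgen v Zv.
  by rewrite big_ord0 add0r.
have gen v' : Z v' -> exists a u w, [/\ lspan s u, B w & v' = a *: e + u + w].
  move=> /Zgen[_ [w [/lspanE[c ->] Bw ->]]].
  rewrite /lincomb big_ord_recl /=; set u := \sum_(i < _) _.
  exists (c ord0), u, w; split=> //.
  by exists (fun i => c (lift ord0 i)); apply: eq_bigr.
apply: (IH _ _ ZxB v Zv) => [v' Zv'|u us]; last first.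
  by apply: sZ; rewrite in_cons us orbT.
have [u1 [w1 [Zu1 Bw1 eE]]] := ZxB e (sZ e (mem_head _ _)).
have [a [u2 [w2 [su2 Bw2 u1E]]]] := gen u1 Zu1.
have [b bE] := unit1x a.
(* Solves [e = x (a e + u2 + w2) + w1] for [e]. *)
have eE' : e = b *: (x *: u2) + b *: (x *: w2 + w1).
  rewrite -scalerDr -[LHS]scale1r -bE -scalerA; congr (_ *: _).
  rewrite scalerBl scale1r {1}eE u1E !scalerDr scalerA; apply/eqP.
  by rewrite subr_eq [X in _ == X]addrC !addrA.
have subS := lspan_submodule s.
have [a' [u3 [w3 [su3 Bw3 ->]]]] := gen v' Zv'.
exists (a' *: (b *: (x *: u2)) + u3), (a' *: (b *: (x *: w2 + w1)) + w3); split.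
- apply: (proj2 subS) => //; apply: submodule_setZ => //.
  exact: submodule_setZ.
- apply: (proj2 subB) => //; apply: submodule_setZ => //.
  exact: (proj2 subB).
- by rewrite {1}eE' scalerDr -!addrA; congr (_ + _); rewrite addrCA.
Qed.

(** A non-unit [1 - x a] would lie in a maximal ideal, which can only be [m]; since [m] contains
    [x a], it would contain 1. *)
Lemma unit_1B (m : set R) (x : R) : local_ring m -> m x ->
  forall a, exists b, b * (1 - x * a) = 1.
Proof.
move=> [[[m0 mD mM] m1 _] muniq] mx a; apply: contrapT => nu.
set u := 1 - x * a in nu.
pose good (J : set R) := [/\ is_ideal J, ~ J 1 & J u].
have [|I [goodI Imax]] := @Zorn_bigcup R (fun J => J = set0 \/ good J).
  move=> F FP Ftot.
  have [[J0 FJ0 goodJ0]|noJ] := pselect (exists2 J, F J & good J); last first.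
    left; rewrite predeqE => y; split=> // -[J FJ Jy].
    have [J0|gJ] := FP J FJ; first by rewrite J0 in Jy.
    by case: noJ; exists J.
  right; split.
  - split.
    + by exists J0 => //; case: goodJ0 => -[].
    + move=> b c [J FJ Jb] [K FK Kc].
      have [JK|KJ] := Ftot J K FJ FK.
        exists K => //; have [K0|[[_ KD _] _ _]] := FP K FK.
          by rewrite K0 in Kc.
        by apply: KD => //; exact: JK.
      exists J => //; have [K0|[[_ KD _] _ _]] := FP J FJ.
        by rewrite K0 in Jb.
      by apply: KD => //; exact: KJ.
    + move=> r b [J FJ Jb]; exists J => //.
      have [K0|[[_ _ KM] _ _]] := FP J FJ; first by rewrite K0 in Jb.
      exact: KM.
  - move=> [J FJ J1]; have [K0|[_ nJ1 _]] := FP J FJ; last exact: nJ1.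
    by rewrite K0 in J1.
  - by exists J0 => //; case: goodJ0.
pose uR : set R := [set y | exists b, y = b * u].
have goodu : good uR.
  split.
  - split; first by exists 0; rewrite mul0r.
      by move=> _ _ [b ->] [c ->]; exists (b + c); rewrite mulrDl.
    by move=> r _ [b ->]; exists (r * b); rewrite mulrA.
  - by move=> [b bE]; apply: nu; exists b.
  - by exists 1; rewrite mul1r.
have {}goodI : good I.
  case: goodI => // I0; case: (Imax uR); last by right.
  rewrite I0; split; first exact: sub0set.
  by move=> /(_ u); apply; exists 1; rewrite mul1r.
have [[I0 ID IM] I1 Iu] := goodI.
have Imaximal : maximal_ideal I.
  split=> // J idJ J1 IJ; apply: contrapT => JI; apply: (Imax J).
    split=> // JsubI; apply: JI; rewrite predeqE => y.
    by split=> [/JsubI|/IJ].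
  by right; split=> //; exact: IJ.
have Im := muniq _ Imaximal; apply: I1.
rewrite -(subrK (x * a) 1); apply: ID; first by [].
by rewrite Im mulrC; exact: mM.
Qed.

End Noetherian.

(** * Reduction modulo x *)

(* [phi] is a phantom argument, which selects the [R]-module structure. *)
Definition restrict (R S : comNzRingType) (phi : {rmorphism R -> S})
  (W : lmodType S) : Type := W.

Section ChangeOfRings.
Variables (R S : comNzRingType) (phi : {rmorphism R -> S}).

Section Restrict.
Variable W : lmodType S.

HB.instance Definition _ := GRing.Zmodule.on (restrict phi W).

Let scale (r : R) (w : restrict phi W) : restrict phi W := phi r *: (w : W).

Fact restrict_scaleA a b v : scale a (scale b v) = scale (a * b) v.
Proof. by rewrite /scale scalerA rmorphM. Qed.
Fact restrict_scale1 : left_id 1 scale.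
Proof. by move=> v; rewrite /scale rmorph1 scale1r. Qed.
Fact restrict_scaleDr : right_distributive scale +%R.
Proof. by move=> a u v; exact: scalerDr. Qed.
Fact restrict_scaleDl v : {morph scale^~ v : a b / a + b}.
Proof. by move=> a b; rewrite /scale rmorphD scalerDl. Qed.

HB.instance Definition _ := GRing.Zmodule_isLmodule.Build R (restrict phi W)
  restrict_scaleA restrict_scale1 restrict_scaleDr restrict_scaleDl.

Lemma restrict_scaleE (r : R) (w : restrict phi W) : r *: w = phi r *: (w : W).
Proof. by []. Qed.

End Restrict.

Lemma restrict_linear (V W : lmodType S) (f : {linear V -> W}) :
  linear (fun v : restrict phi V => f v : restrict phi W).
Proof. by move=> a u v; rewrite !restrict_scaleE; exact: linearP. Qed.

Definition restrict_lin (V W : lmodType S) (f : {linear V -> W}) :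
  {linear restrict phi V -> restrict phi W} := linear_of (restrict_linear f).

(** * The ring R/xR, presented by a surjection with kernel xR *)

Variable x : R.
Hypothesis phi_surj : forall s, exists r, phi r = s.
Hypothesis phi_ker : forall r, phi r = 0 <-> exists t, r = t * x.

Lemma restrict_x (W : lmodType S) (w : restrict phi W) : x *: w = 0.
Proof.
have phix : phi x = 0 by apply/phi_ker; exists 1; rewrite mul1r.
rewrite restrict_scaleE phix; exact: (scale0r (w : W)).
Qed.

(* [q] identifies the [S]-module [B] with [A / xA]. *)
Definition reduction (A : lmodType R) (B : lmodType S)
    (q : {linear A -> restrict phi B}) :=
  (forall b, exists a, q a = b) /\ (forall a, q a = 0 -> exists a', x *: a' = a).

Lemma reduction_factor (A : lmodType R) (B W : lmodType S)
    (q : {linear A -> restrict phi B}) (f : {linear A -> restrict phi W}) :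
  (forall b, exists a, q a = b) -> (forall a, q a = 0 -> f a = 0) ->
  exists g : {linear B -> W}, forall a, g (q a) = f a.
Proof.
move=> /choice[l lE] qf.
have gE a : f (l (q a)) = f a.
  by apply/eqP; rewrite -subr_eq0 -linearB qf // linearB lE subrr.
pose g (b : B) : W := f (l b).
have gL : linear g.
  move=> s u v; have [r <-] := phi_surj s.
  (* Every scalar of [S] comes from [R], so R-linearity of [f] gives S-linearity of [g]. *)
  have -> : phi r *: u + v = q (r *: l u + l v).
    by rewrite linearP !lE.
  by rewrite /g gE linearP.
by exists (linear_of gL) => a; exact: gE.
Qed.

(** Half of the adjunction Hom_R(A, W) = Hom_S(A/xA, W): [x] kills [W], so [f] kills [xA]. *)
Lemma reduction_hom (A : lmodType R) (B W : lmodType S)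
    (q : {linear A -> restrict phi B}) (f : {linear A -> restrict phi W}) :
  reduction q -> exists g : {linear B -> W}, forall a, g (q a) = f a.
Proof.
move=> [qsurj qker]; apply: reduction_factor => // a /qker[a' <-].
by rewrite linearZ; exact: restrict_x.
Qed.

Lemma reduction_short_exact (A : lmodType R) (B : lmodType S)
    (q : {linear A -> restrict phi B}) :
  reduction q -> regular_on x A ->
  exists j : {linear A -> A}, short_exact j q.
Proof.
move=> [qsurj qker] xA.
have xL : linear ( *:%R x : A -> A).
  by move=> a u v; rewrite scalerDr !scalerA mulrC.
exists (linear_of xL); split=> // v; split=> [/qker[a <-]|[a <-]].
  by exists a.
by rewrite linearZ; exact: restrict_x.
Qed.

Lemma reduction_ring : exists q : {linear R^o -> restrict phi S^o},
  reduction q.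
Proof.
have pL : linear (phi : R^o -> restrict phi S^o).
  by move=> a u v; rewrite rmorphD rmorphM.
exists (linear_of pL); split=> [s|r /phi_ker[t ->]]; first exact: phi_surj.
by exists t; rewrite mulrC.
Qed.

Lemma reduction_free n :
  exists q : {linear free_module R n -> restrict phi (free_module S n)},
    reduction q.
Proof.
have pL : linear (fun c : free_module R n =>
      [ffun i => phi (c i)] : restrict phi (free_module S n)).
  by move=> a u v; apply/ffunP => i; rewrite !ffunE rmorphD rmorphM.
exists (linear_of pL); split=> [b|a a0].
  have [l lE] := choice phi_surj.
  by exists [ffun i => l (b i)]; apply/ffunP => i; rewrite !ffunE lE.
have /choice[t tE] i : exists t, a i = t * x.
  apply/phi_ker; have /(congr1 (fun c : free_module S n => c i)) := a0.
  by rewrite !ffunE.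
by exists [ffun i => t i]; apply/ffunP => i; rewrite !ffunE tE mulrC.
Qed.

Section Transfer.
Variables (A2 A1 A0 : lmodType R) (B2 B1 B0 : lmodType S).
Variables (d1 : {linear A2 -> A1}) (d0 : {linear A1 -> A0}).
Variables (e1 : {linear B2 -> B1}) (e0 : {linear B1 -> B0}).
Variables (q2 : {linear A2 -> restrict phi B2})
  (q1 : {linear A1 -> restrict phi B1}) (q0 : {linear A0 -> restrict phi B0}).
Hypotheses (red2 : reduction q2) (red1 : reduction q1) (red0 : reduction q0).
Hypotheses (qd1 : forall a, q1 (d1 a) = e1 (q2 a))
  (qd0 : forall a, q0 (d0 a) = e0 (q1 a)).

(** By adjunction Hom_R(A, W) and Hom_S(B, W) agree degreewise, compatibly with the
    differentials. *)
Lemma vanishes_reduction W :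
  vanishes W e1 e0 <-> vanishes (restrict phi W) d1 d0.
Proof.
split=> vW f fd.
  have [f' f'E] := reduction_hom f red1.
  have [|g gE] := vW f'.
    move=> z; have [a <-] := red2.1 z.
    by rewrite -qd1 f'E fd.
  by exists (restrict_lin g \o q0) => y; rewrite /= qd0 -gE f'E.
have [|g gE] := vW (restrict_lin f \o q1).
  by move=> z; rewrite /= qd1 fd.
have [g' g'E] := reduction_hom g red0.
exists g' => y; have [a <-] := red1.1 y.
by rewrite -qd0 g'E -gE.
Qed.

End Transfer.

(** Every cocycle becomes a coboundary in V/xV, hence is [x] times a cocycle plus a coboundary;
    Nakayama's lemma then applies to the cocycles modulo coboundaries. *)
Lemma vanishes_nakayama n (V A2 A0 : lmodType R) (B : lmodType S)
    (q : {linear V -> restrict phi B}) (d1 : {linear A2 -> free_module R n})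
    (d0 : {linear free_module R n -> A0}) :
  (forall a, exists b, b * (1 - x * a) = 1) ->
  reduction q -> regular_on x V -> noetherian_module V -> projective A0 ->
  (forall z, d0 (d1 z) = 0) ->
  vanishes (restrict phi B) d1 d0 -> vanishes V d1 d0.
Proof.
move=> unit1x [qsurj qker] xV nV PA0 d01 vB f fd.
(* Maps out of R^n are stored as tuples in the Noetherian module V^n, so that the cocycles are
   finitely generated. *)
pose values (g : {linear free_module R n -> V}) : {ffun 'I_n -> V} :=
  [ffun i => g (delta R i)].
have valuesE g c : lincomb (values g) c = g c.
  by rewrite [RHS]linear_lincomb; apply: eq_bigr => i _; rewrite ffunE.
have lincombL (u v : {ffun 'I_n -> V}) a c :
    lincomb (a *: u + v) c = a *: lincomb u c + lincomb v c.
  rewrite /lincomb scaler_sumr -big_split; apply: eq_bigr => i _ /=.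
  by rewrite !ffunE scalerDr !scalerA mulrC.
have lincomb0 c : lincomb (0 : {ffun 'I_n -> V}) c = 0.
  by apply: big1 => i _; rewrite ffunE scaler0.
pose Z (v : {ffun 'I_n -> V}) := forall z, lincomb v (d1 z) = 0.
pose Bd (v : {ffun 'I_n -> V}) :=
  exists g : {linear A0 -> V}, forall c, lincomb v c = g (d0 c).
have subZ : submodule_set Z.
  split=> [z|a u v Zu Zv z]; first exact: lincomb0.
  by rewrite lincombL Zu Zv scaler0 addr0.
have subB : submodule_set Bd.
  split=> [|a u v [g gE] [h hE]].
    by exists (GRing.null_fun V : {linear A0 -> V}) => c; rewrite lincomb0.
  exists ((a \*: g) \+ h) => c.
  by rewrite lincombL gE hE.
have [s sE] := noetherian_power nV subZ.
have [g gE] : Bd (values f); last by exists g => y; rewrite -gE valuesE.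
apply: (nakayama unit1x subB (s := s) (Z := Z)) => [v /sE vs|v vs|v Zv|z].
- by exists v, 0; split; rewrite ?addr0 //; case: subB.
- exact/sE/lspan_mem.
- have [|g gE] := vB (q \o lincomb_lin v); first by move=> z; rewrite /= Zv linear0.
  have [g' g'E] := PA0 _ _ q g qsurj.
  (* The difference reduces to 0, hence is divisible by [x]; the quotient is again a cocycle as [x]
     is regular on [V]. *)
  have [|f' f'E] := linear_divide (f := lincomb_lin v \- (g' \o d0)) xV.
    by move=> c; apply: qker; rewrite linearB /= g'E -gE subrr.
  exists (values f'), (values (g' \o d0)); split=> [z||].
  + by rewrite valuesE; apply: xV; rewrite -f'E /= Zv d01 linear0 subr0.
  + by exists g' => c; rewrite valuesE.
  + by apply/ffunP => i; rewrite !ffunE -f'E /= lincomb_delta subrK.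
- by rewrite valuesE fd.
Qed.

(** * Passage of (SAC) from S to R *)

Hypothesis xreg : GRing.lreg x.

Theorem SAC_ascent : noetherian R ->
  (forall a, exists b, b * (1 - x * a) = 1) -> SAC S -> SAC R.
Proof.
move=> nR unit1x sacS M fgM vR [k vM].
have [F] := fg_free_resolution nR fgM.
pose P := proj_of_free F; pose d := fr_d F; pose n := fr_rank F.
have dd i z : d i (d i.+1 z) = 0 by apply/(@fr_exactS _ _ F); exists z.
have vRd i : vanishes R^o (d i.+1) (d i) by apply/(Ext_zeroP R^o P)/vR.
have Pfree m : projective (free_module R m) by exact: free_projective.
have xfree m : regular_on x (free_module R m) by exact: free_regular.
have [p pE] : exists p : {linear free_module R (n 1) -> submod (ker (fr_aug F))},
    forall y, submod_incl _ (p y) = d 0 y.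
  by apply: corestrict => y; apply/(@fr_exact0 _ _ F); exists y.
have psurj w : exists y, p y = w.
  have : ker (fr_aug F) (submod_incl _ w) by apply/submod_inclP; exists w.
  move=> /(@fr_exact0 _ _ F)[y yE]; exists y.
  apply/eqP; rewrite -subr_eq0; apply/eqP/submod_incl_inj.
  by rewrite linearB pE yE subrr.
have p0 y : p y = 0 <-> d 0 y = 0.
  split=> [py|dy]; first by rewrite -pE py linear0.
  by apply: submod_incl_inj; rewrite pE.
(* For the second syzygy, F_1/N embeds in F_0, so [x] is regular on it and N/xN embeds in
   F_1/xF_1. *)
pose N := submod (ker p).
have Nmem y : d 0 y = 0 -> exists w : N, submod_incl _ w = y.
  by move=> dy; apply/submod_inclP/p0.
have dN (w : N) : d 0 (submod_incl _ w) = 0.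
  by apply/p0/(submod_inclP (ker p)); exists w.
(* Hom(F, R) is exact in positive degrees, so two dimension shifts in the second argument give
   Ext^(i+3)(M, N); truncating F identifies this with Ext^(i+1)(N, N). *)
have syzygy i : vanishes M (d i.+1) (d i) <-> vanishes N (d i.+3) (d i.+2).
  have e1 := ker_short_exact (@fr_aug_surj _ _ F).
  have e2 := ker_short_exact psurj.
  split=> vi.
    apply: (vanishes_sub e2 (Pfree _) (dd _)); last exact: vanishes_free.
    by apply: (vanishes_sub e1 (Pfree _) (dd _) vi); exact: vanishes_free.
  apply: (vanishes_quotient e1 (Pfree _) (dd _) (dd _)); last exact: vanishes_free.
  apply: (vanishes_quotient e2 (Pfree _) (dd _) (dd _) vi); exact: vanishes_free.
pose q i := sval (cid (reduction_free (n i))).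
have redq i : reduction (q i) := svalP (cid (reduction_free (n i))).
have qx i a : q i (x *: a) = 0 by rewrite linearZ; exact: restrict_x.
have eP i := cid (reduction_hom (q i \o d i) (redq i.+1)).
pose e i := sval (eP i).
have qd i a : q i (d i a) = e i (q i.+1 a) by rewrite [RHS](svalP (eP i)).
(* If [d a = x b], then [d b = 0] by regularity, [b = d c], and [a - x c] is a cycle with the same
   reduction as [a]. One degree lower this would need [x] to be regular on [M]. *)
have exact_e i y : e i.+1 y = 0 <-> exists z, e i.+2 z = y.
  split=> [|[z <-]]; last first.
    by have [a <-] := (redq _).1 z; rewrite -!qd dd linear0.
  have [a <-] := (redq _).1 y; rewrite -qd => /(proj2 (redq _))[b bE].
  have /(@fr_exactS _ _ F)[c cE] : d i b = 0.
    by apply: xfree; rewrite -linearZ bE dd.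
  have /(@fr_exactS _ _ F)[z zE] : d i.+1 (a - x *: c) = 0.
    by rewrite linearB linearZ /= [d _ c]cE bE subrr.
  by exists (q _ z); rewrite -qd [d _ z]zE linearB qx subr0.
have [aug augE] : exists aug : {linear free_module S (n 2) -> submod (im (e 1))},
    forall y, submod_incl _ (aug y) = e 1 y.
  by apply: corestrict => y; exists y.
have aug_surj u : exists y, aug y = u.
  have /submod_inclP[y yE] : exists w, submod_incl (im (e 1)) w = submod_incl _ u.
    by exists u.
  exists y; apply/eqP; rewrite -subr_eq0; apply/eqP/submod_incl_inj.
  by rewrite linearB augE yE subrr.
have aug0 y : aug y = 0 <-> exists z, e 2 z = y.
  rewrite -exact_e; split=> [a0|e0]; first by rewrite -augE a0 linear0.
  by apply: submod_incl_inj; rewrite augE.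
(* This is N/xN, as [redN] shows; its resolution is the reduction of F from degree 2 on. *)
pose Nb : lmodType S := submod (im (e 1)).
pose PS := @ProjResolution S Nb (fun i => free_module S (n i.+2))
  (fun i => e i.+2) aug (fun i => @free_projective S _) aug_surj aug0
  (fun i => exact_e i.+1).
have inclNb_inj (w : restrict phi Nb) :
  restrict_lin (V := Nb) (submod_incl (im (e 1))) w = 0 -> w = 0.
  exact: (@submod_incl_inj _ _ (im (e 1)) w).
have [|qN qNE] := linear_factor_inj (f := q 1 \o submod_incl (ker p)) inclNb_inj.
  move=> w; have /(@fr_exactS _ _ F)[z zE] := dN w.
  exists (aug (q 2 z)).
  by rewrite -[LHS]/(submod_incl (im (e 1)) (aug (q 2 z))) augE -qd [d 1 z]zE.
have redN : reduction qN.
  split=> [w|w w0].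
    have [y <-] := aug_surj w; have [a <-] := (redq _).1 y.
    have [u uE] := Nmem _ (dd 0 a); exists u.
    apply/eqP; rewrite -subr_eq0; apply/eqP/inclNb_inj.
    rewrite linearB qNE -[X in X - _]/(q 1 (submod_incl (ker p) u)) uE qd -augE.
    exact: subrr.
  have [b bE] : exists b, x *: b = submod_incl _ w.
    by apply: (redq 1).2; have := qNE w; rewrite w0 linear0.
  have [|u uE] := Nmem b; first by apply: xfree; rewrite -linearZ bE dN.
  exists u; apply/eqP; rewrite -subr_eq0; apply/eqP/submod_incl_inj.
  by rewrite linearB -bE -uE linearZ; exact: subrr.
have xN : regular_on x N by exact: submod_regular.
(* Multiplication by [x] on [V] puts Ext_S^(i+1)(N/xN, V/xV) between Ext_R^(i+1)(N, V) and
   Ext_R^(i+2)(N, V). *)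
have reduce (V : lmodType R) (W : lmodType S)
    (qV : {linear V -> restrict phi W}) i :
    reduction qV -> regular_on x V ->
    vanishes V (d i.+4) (d i.+3) -> vanishes V (d i.+3) (d i.+2) ->
    Ext_zero Nb W i.+1.
  move=> redV xV v1 v2; have [j ex] := reduction_short_exact redV xV.
  apply/(Ext_zeroP W PS).
  apply/(vanishes_reduction (redq _) (redq _) (redq _) (qd _) (qd _)).
  exact: vanishes_quotient ex (Pfree _) (dd _) (dd _) v1 v2.
have vNb : forall i, (0 < i)%N -> Ext_zero Nb Nb i.
  apply: sacS.
  - exact: fg_module_surj aug_surj (fg_module_free S _).
  - case=> // i _; have [qR redR] := reduction_ring; apply: (reduce _ _ qR) => //.
    by move=> r r0; apply: xreg; rewrite mulr0.
  (* The bound [k.+1] excludes degree 0. *)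
  - exists k.+1 => -[//|i] ki.
    apply: (reduce _ _ qN) => //; apply/syzygy/(Ext_zeroP M P)/vM => //.
      exact: leq_trans (ltnW ki) _.
    exact: ltnW.
case=> // i _; apply/(Ext_zeroP M P)/syzygy.
apply: (vanishes_nakayama unit1x redN xN) => //.
  by apply: noetherian_inj (@submod_incl_inj _ _ _) _; exact: noetherian_free.
have /(Ext_zeroP _ PS) := vNb i.+1 isT.
by move=> /(vanishes_reduction (redq _) (redq _) (redq _) (qd _) (qd _)).
Qed.

(** * Passage of (SAC) from R to S *)

Lemma noetherian_quotient : noetherian R -> noetherian S.
Proof.
move=> nR I [I0 ID IM].
have [|s sE] := nR (fun r => I (phi r)).
  split=> [|a b Ia Ib|r a Ia]; first by rewrite rmorph0.
    by rewrite rmorphD; exact: ID.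
  by rewrite rmorphM; exact: IM.
exists (map phi s); rewrite predeqE => y; split=> [Iy|].
  have [r ry] := phi_surj y.
  have [c cE] : ideal_gen s r by rewrite -sE /= ry.
  have -> : y = \sum_(i < size s) phi (c i) * phi s`_i.
    by rewrite -ry cE rmorph_sum; apply: eq_bigr => i _; rewrite -rmorphM.
  apply: (big_ind (ideal_gen (map phi s))) => [|u v|i _].
  - by case: (lspan_submodule (map phi s : seq S^o)).
  - exact: (submodule_setD (lspan_submodule (map phi s : seq S^o))).
  - apply: (submodule_setZ (phi (c i)) (lspan_submodule (map phi s : seq S^o))).
    by apply: (@lspan_mem _ S^o); rewrite map_f ?mem_nth.
have subI : submodule_set (I : S^o -> Prop).
  by split=> // a u v Iu Iv; apply: ID => //; exact: IM.
apply: (lspan_min subI) => _ /mapP[r rs ->].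
suff : ideal_gen s r by rewrite -sE.
exact: (@lspan_mem _ R^o).
Qed.

(* A free resolution of [N] over [S] lifts to maps [d] of free [R]-modules with
   [d d = x theta]; the matrices [(d, x; - theta, - d)] then resolve over [R]
   the first syzygy [M] of [N] (Eisenbud, Shamash). *)
Theorem SAC_descent : noetherian R -> SAC R -> SAC S.
Proof.
move=> nR sacR N fgN vS [k vN].
have [F] := fg_free_resolution (noetherian_quotient nR) fgN.
pose P := proj_of_free F; pose e := fr_d F; pose n := fr_rank F.
have ee i z : e i (e i.+1 z) = 0 by apply/(@fr_exactS _ _ F); exists z.
pose Q i := free_module R (n i).
have PQ i : projective (Q i) by exact: free_projective.
have xQ i : regular_on x (Q i) by exact: free_regular.
pose q i := sval (cid (reduction_free (n i))).
have redq i : reduction (q i) := svalP (cid (reduction_free (n i))).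
have dP i := cid (PQ i.+1 _ _ (q i) (restrict_lin (e i) \o q i.+1) (redq i).1).
pose d i : {linear Q i.+1 -> Q i} := sval (dP i).
have qd i a : q i (d i a) = e i (q i.+1 a) by rewrite [LHS](svalP (dP i)).
have thetaP i : exists t : {linear Q i.+2 -> Q i},
    forall a, d i (d i.+1 a) = x *: t a.
  apply: (linear_divide (f := d i \o d i.+1)) => // a.
  by apply: (redq i).2; rewrite /= qd qd ee.
pose theta i := sval (cid (thetaP i)).
have dd i a : d i (d i.+1 a) = x *: theta i a := svalP (cid (thetaP i)) a.
(* Both sides times [x] equal [d d d]. *)
have thetad i a : theta i (d i.+2 a) = d i (theta i.+1 a).
  apply/eqP; rewrite -subr_eq0; apply/eqP/(xQ i).
  by rewrite scalerBr -dd -linearZ -dd subrr.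
pose obj i : lmodType R := (Q i.+1 * Q i)%type.
have Pobj i : projective (obj i) by exact: prod_projective.
(* The first coordinate of the differential; [D0 0] also maps [obj 0] onto the syzygy [M]. *)
pose D0 i (p : obj i) : Q i := d i p.1 + x *: p.2.
have D0_linear i : linear (@D0 i).
  by move=> a u v; rewrite /D0 /= !linearP !scalerDr !scalerA mulrC addrACA.
pose D1 i (p : obj i.+1) : obj i := (D0 i.+1 p, - theta i p.1 - d i p.2).
have D1_linear i : linear (@D1 i).
  move=> a u v; rewrite /D1 D0_linear; congr pair.
  by rewrite /= !linearP /= scalerDr addrACA.
pose D i := linear_of (@D1_linear i).
have D01 i z : D0 i (D i z) = 0.
  case: z => a b; rewrite /D0 /= /D0 /= linearD linearZ /= dd.
  by rewrite scalerBr scalerN addrACA subrr add0r subrr.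
have D1D1 i z : D i (D i.+1 z) = 0.
  congr pair; first exact: (D01 i.+1 z).
  case: z => a b; rewrite /= /D0 /= linearD linearB linearN linearZ /= dd thetad.
  by rewrite -2!opprD subrr oppr0.
(* Only [a = d c + x c2] has to be solved; the second coordinate then agrees after multiplication by
   [x], hence agrees. *)
have D0_exact i (p : obj i) : D0 i p = 0 -> exists z, D i z = p.
  case: p => a b; rewrite /D0 /= => p0.
  have qa : e i (q i.+1 a) = 0.
    have /(congr1 (q i)) := p0; rewrite linearD linear0 qd linearZ /=.
    by rewrite restrict_x addr0.
  have /(@fr_exactS _ _ F)[c' cE] := qa; have [c cc] := (redq i.+2).1 c'.
  have [c2 c2E] : exists c2, x *: c2 = a - d i.+1 c.
    by apply: (redq i.+1).2; rewrite linearB qd cc [X in _ - X]cE subrr.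
  exists (c, c2); have aE : d i.+1 c + x *: c2 = a by rewrite c2E addrC subrK.
  congr pair; rewrite /D0 /= ?aE //.
  apply/eqP; rewrite -subr_eq0; apply/eqP/(xQ i).
  have /(congr1 (d i)) := aE; rewrite linearD linearZ /= dd => daE.
  rewrite !scalerBr scalerN -opprD daE -opprD p0.
  by rewrite oppr0.
pose eps : {linear Q 0 -> restrict phi N} := restrict_lin (fr_aug F) \o q 0.
have eps_surj w : exists y, eps y = w.
  have [y <-] := fr_aug_surj F w; have [a <-] := (redq 0).1 y.
  by exists a.
pose M : lmodType R := submod (ker eps).
have epsD0 p : eps (D0 0 p) = 0.
  case: p => a b; rewrite /D0 linearD /=.
  have -> : q 0 (x *: b) = 0 by rewrite linearZ; exact: restrict_x.
  rewrite qd linear0 addr0.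
  by apply/(@fr_exact0 _ _ F); exists (q 1 a).
have [aug augE] : exists aug : {linear obj 0 -> M},
    forall p, submod_incl _ (aug p) = D0 0 p.
  exact: (corestrict (A := ker eps) (f := linear_of (D0_linear 0))) epsD0.
have aug_surj w : exists p, aug p = w.
  have : fr_aug F (q 0 (submod_incl _ w)) = 0.
    by apply/(submod_inclP (ker eps)); exists w.
  move=> /(@fr_exact0 _ _ F)[z']; have [z <-] := (redq 1).1 z'.
  move=> zE; have [b bE] : exists b, x *: b = submod_incl _ w - d 0 z.
    by apply: (redq 0).2; rewrite linearB qd [X in _ - X]zE subrr.
  exists (z, b); apply/eqP; rewrite -subr_eq0; apply/eqP/submod_incl_inj.
  by rewrite linearB augE /D0 /= bE addrCA subrr addr0; exact: subrr.
have aug0 p : aug p = 0 <-> exists z, D 0 z = p.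
  split=> [p0|[z <-]]; last by apply: submod_incl_inj; rewrite augE D01.
  by apply: D0_exact; rewrite -augE p0 linear0.
have D_exact i p : D i p = 0 <-> exists z, D i.+1 z = p.
  split=> [|[z <-]]; last exact: D1D1.
  by move=> /(congr1 fst) /= /D0_exact.
pose PM := @ProjResolution R M obj D aug Pobj aug_surj aug0 D_exact.
have to_d (W : lmodType S) i :
    Ext_zero N W i.+1 <-> vanishes (restrict phi W) (d i.+1) (d i).
  rewrite (Ext_zeroP W P i).
  exact: (vanishes_reduction (redq _) (redq _) (redq _) (qd _) (qd _)).
(* Rees's shift from Ext_S^(i+1)(N, S) to Ext_R^(i+1)(M, R): modulo [x] the component [g1] is a
   cocycle for [N], and [(h, -g)] bounds [f]. *)
have vRD i : vanishes R^o (D i.+1) (D i).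
  have [qR [qR_surj qR_ker]] := reduction_ring.
  have xR : regular_on x R^o by move=> r r0; apply: xreg; rewrite mulr0.
  move=> f fD; have [f1 [g1 fE]] := linear_pair f.
  have fD1 a : x *: f1 a = g1 (d i.+1 a).
    have := fD (0, a); rewrite fE /D0 /=. rewrite !linear0 !add0r.
    by rewrite linearZ linearN /= => /subr0_eq.
  have [|g' g'E] := (to_d S^o i).1 (vS i.+1 isT) (qR \o g1).
    by move=> z; rewrite /= -fD1 linearZ; exact: restrict_x.
  have [g gE] := PQ i _ _ qR g' qR_surj.
  have [|h hE] := linear_divide (f := g1 \- (g \o d i)) xR.
    by move=> a; apply: qR_ker; rewrite linearB /= gE -g'E subrr.
  have g1E a : g1 a = x *: h a + g (d i a) by rewrite -hE subrK.
  exists (copair h (\- g)) => -[a b]; rewrite fE /D0 /=.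
  rewrite linearD linearZ /= linearB linearN /=.
  rewrite -opprD opprK addrACA -g1E.
  congr (_ + _); apply/eqP; rewrite -subr_eq0; apply/eqP/xR.
  by rewrite scalerBr fD1 g1E dd linearZ /= scalerDr subrr.
(* The exact piece Ext_S^(i+2)(N, N) -> Ext_R^(i+1)(M, N) -> Ext_S^(i+1)(N, N): [g1] is bounded
   first, then what remains of [f1]. *)
have vN_D i : Ext_zero N N i.+1 -> Ext_zero N N i.+2 ->
    vanishes (restrict phi N) (D i.+1) (D i).
  move=> /to_d v1 /to_d v2 f fD; have [f1 [g1 fE]] := linear_pair f.
  have fD1 a : f1 (d i.+2 a) = g1 (theta i.+1 a).
    have := fD (a, 0); rewrite fE /D0 /= scaler0 addr0 linear0 subr0.
    by rewrite linearN /= => /subr0_eq.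
  have [|g gE] := v1 g1.
    move=> a; have := fD (0, a); rewrite fE /D0 /= !linear0 !add0r.
    rewrite linearZ linearN /= restrict_x add0r => /eqP.
    by rewrite oppr_eq0 => /eqP.
  have [|h hE] := v2 (f1 \- (g \o theta i)).
    by move=> a; rewrite /= fD1 gE thetad subrr.
  exists (copair h (\- g)) => -[a b]; rewrite fE /D0 /=.
  rewrite linearD linearZ /= restrict_x addr0 -hE /=.
  by rewrite linearB linearN /= -opprD opprK addrA subrK gE.
(* The next map of that sequence is composition with [theta], into Ext_S^(i+3)(N, N); a cocycle [f]
   that it kills extends to a cocycle [(g, f)] of Hom(D, N). *)
have vN_d i : Ext_zero N N i.+3 -> vanishes (restrict phi N) (D i.+1) (D i) ->
    Ext_zero N N i.+1.
  move=> /to_d v3 vD; apply/to_d => f fd.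
  have [|g gE] := v3 (f \o theta i.+1); first by move=> a; rewrite /= thetad fd.
  have [|h hE] := vD (copair g f).
    case=> a b; rewrite /D0 /= linearD linearZ /= restrict_x addr0.
    by rewrite linearB linearN /= fd subr0 -gE subrr.
  have [h1 [h2 h12]] := linear_pair h.
  exists (\- h2) => y; have := hE (0, y).
  rewrite h12 /D0 /= !linear0 !add0r => ->.
  by rewrite linearZ linearN /= restrict_x add0r.
have ex := ker_short_exact eps_surj.
have vM : forall i, (0 < i)%N -> Ext_zero M M i.
  apply: sacR => [||].
  - apply: (fg_module_surj aug_surj).
    by apply: fg_module_prod; exact: fg_module_free.
  - by case=> // i _; apply/(Ext_zeroP R^o PM).
  (* Replacing [M] by [N] in the second argument lowers the degree by one, and that degree must stay
     positive. *)
  - exists k.+2 => -[|[|i]] // ki; apply/(Ext_zeroP M PM).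
    apply: (vanishes_sub ex (Pobj _) (D1D1 _)); last exact: vanishes_free.
    by apply: vN_D; apply: vN; do ?apply: leqW.
(* Ext_R^(i+1)(M, N) lies between Ext_R^(i+1)(M, Q_0) and Ext_R^(i+2)(M, M), both zero. *)
have {}vN_D i : vanishes (restrict phi N) (D i.+1) (D i).
  apply: (vanishes_quotient ex (Pobj _) (D1D1 _) (D1D1 _)).
    exact/(Ext_zeroP M PM)/vM.
  exact: vanishes_free.
(* [l] bounds the distance to the vanishing range; it drops by one while the degree rises by two. *)
have descend l i : (k <= l + i)%N -> Ext_zero N N i.+1.
  elim: l i => [|l IH] i ki; first by apply/vN/leqW.
  by apply: vN_d => //; apply: IH; rewrite !addnS -addSn leqW.
by case=> // i _; apply: (descend k); rewrite leq_addr.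
Qed.

End ChangeOfRings.

Theorem corollary2p5 (R : comNzRingType) (m : set R) (x : R)
    (noethR : noetherian R) (localR : local_ring m)
    (depthR : positive_depth m) (mx : m x) (regx : GRing.lreg x) :
  SAC R <-> SAC (principal_quot (local_nonunit localR mx)).
Proof.
set nu := local_nonunit localR mx.
(* Surjectivity and kernel of the projection are all that both implications ask of the quotient. *)
pose phi : {rmorphism R -> principal_quot nu} :=
  \pi_{ideal_quot (principal_idealr nu)}%qT.
have phi_surj s : exists r, phi r = s by exists (repr s); exact: reprK.
have phi_ker r : phi r = 0 <-> exists t, r = t * x.
  have -> : (exists t, r = t * x) <-> r - 0 \in principal_idealr nu.
    by rewrite subr0; split=> [?|/asboolP //]; apply/asboolP.
  rewrite Quotient.idealrBE -(rmorph0 phi).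
  by split=> [/eqP|/eqP].
split.
- exact: (SAC_descent phi_surj phi_ker regx noethR).
- exact: (SAC_ascent phi_surj phi_ker regx noethR (unit_1B localR mx)).
Qed.
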